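(* Fix $t\in\mathbb{R}$ and let $\alpha_{i,n}$ be the local levels of the one-sided HC test with critical values $h_{i,n}(d_n(t))$. Let $i_n\in\{1,\dots,n\}$ be a sequence of ranks with $(n-i_n)/u_n\to0$ as $n\to\infty$. Then (for $i_n\le n-1$) $$\alpha_{i_n,n}=\frac{\sqrt{\pi}\exp(-2t)}{\sqrt{2(n-i_n)}}\,\frac{1}{u_n\log(n)^2}\Bigl(\frac{u_n}{\gamma(n-i_n)}\Bigr)^{n-i_n}\exp\bigl((n-i_n)w_n\bigr)\Bigl[1+O\Bigl(\frac1{n-i_n}\Bigr)+o(1)\Bigr],$$ where $\gamma=\exp(1)/2$ and $$w_n=\frac{\log(u_n)+2t-\log(\pi)+3(n-i_n)}{2u_n}\,[1+o(1)].$$ Moreover, if in addition $n-i_n=o(\sqrt{u_n})$, then $$\alpha_{i_n,n}=\frac{\pi\exp(-2t)}{u_n\log(n)^2}\Bigl(\frac{2u_n}{\exp(2)}\Bigr)^{n-i_n}\frac{1}{(n-i_n)!}\,[1+o(1)].$$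
   Context: Let $u_n=\log(\log(n))$ and, for fixed $t\in\mathbb{R}$, $d_n(t)=\bigl(t+2u_n+(\log(u_n)-\log(\pi))/2\bigr)/\sqrt{2u_n}$ (everything is considered for $n$ large enough to be defined with $d_n(t)\ge1$). For $1\le i\le n$ let $$h_{i,n}(d)=\frac{d^2+2i-d\sqrt{d^2+4i-4i^2/n}}{2(d^2+n)}.$$ The local levels of the one-sided higher criticism (HC) test based on $d_n(t)$ are $\alpha_{i,n}=\mathbb{P}(U_{i:n}<h_{i,n}(d_n(t)))=\mathbb{P}(Z_n\ge i)$, where $U_{i:n}$ is the $i$th order statistic of $n$ i.i.d. uniform random variables on $[0,1]$ and $Z_n$ is binomial with parameters $n$ and $h_{i,n}(d_n(t))$. Asymptotic symbols refer to $n\to\infty$; the first formula means that there is a sequence $w_n$ with the stated asymptotics for which it holds. *)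

(* Defs.v *)
From HB Require Import structures.
From mathcomp Require Import all_boot all_order all_algebra.
From mathcomp Require Import all_classical all_reals all_analysis.

Set Implicit Arguments.
Unset Strict Implicit.
Unset Printing Implicit Defensive.

Import Order.TTheory GRing.Theory Num.Theory.
Import numFieldNormedType.Exports.

Local Open Scope classical_set_scope.
Local Open Scope ring_scope.

(* Junk values of ln, Num.sqrt and ^-1 (small n) are harmless: all claims
   about these sequences are asymptotic. *)
Definition loglog (R : realType) (n : nat) : R := ln (ln n%:R).

Definition hc_d (R : realType) (t : R) (n : nat) : R :=
  (t + 2 * loglog R n + (ln (loglog R n) - ln pi) / 2)
    / Num.sqrt (2 * loglog R n).

Definition hc_crit (R : realType) (i n : nat) (d : R) : R :=
  (d ^+ 2 + 2 * i%:R
     - d * Num.sqrt (d ^+ 2 + 4 * i%:R - 4 * i%:R ^+ 2 / n%:R))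
    / (2 * (d ^+ 2 + n%:R)).

(* U_{i:n}(x), the i-th smallest of the n values U k x, for 1 <= i <= n. *)
Definition order_stat (R : realType) (T : Type) (n : nat)
    (U : 'I_n -> T -> R) (i : nat) (x : T) : R :=
  nth 0 (sort <=%R [seq U k x | k <- enum 'I_n]) i.-1.

(* Taking B k := setT recovers the product rule for every subfamily. *)
Definition mutually_independent (R : realType) (d : measure_display)
    (T : measurableType d) (P : probability T R) (n : nat)
    (U : 'I_n -> {RV P >-> R}) : Prop :=
  forall B : 'I_n -> set R, (forall k, measurable (B k)) ->
    P [set x | forall k, B k (U k x)] = (\prod_(k < n) P (U k @^-1` B k))%E.

Definition iid_uniform (R : realType) (d : measure_display)
    (T : measurableType d) (P : probability T R) (n : nat)
    (U : 'I_n -> {RV P >-> R}) : Prop :=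
  mutually_independent U /\
  forall (k : 'I_n) (B : set R), measurable B ->
    distribution P (U k) B = uniform_prob (@ltr01 R) B.

(* alpha_{i,n} = P(U_{i:n} < h_{i,n}(d)) *)
Definition local_level (R : realType) (d : measure_display)
    (T : measurableType d) (P : probability T R) (n : nat)
    (U : 'I_n -> {RV P >-> R}) (delta : R) (i : nat) : R :=
  fine (P [set x | order_stat (fun k => U k : T -> R) i x
                     < hc_crit i n delta]).

(* Main.v *)
Require Import Defs.
From HB Require Import structures.
From mathcomp Require Import all_boot all_order all_algebra.
From mathcomp Require Import all_classical all_reals all_analysis.
From mathcomp Require Import ring lra zify.

(** Write [m = n - i], [q = 1 - h], [nu = n q], [D = d^2], [u = log log n] and
    [L = log u + 2 t - log pi].

    The order statistic [U_{i:n}] lies below [h] exactly when at least [i] of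
    the [n] variables do, that is, when at most [m] of them do not; by
    independence the local level is the lower tail at [m] of a binomial
    distribution with parameters [n] and [q] ([local_level_binomial]).  Here
    [nu] is of order [2 u] while [m = o(u)], so consecutive binomial weights
    below [m] grow at least by the factor [nu / (2 m)], which tends to infinity:
    the tail is its last term up to a factor [1 + o(1)].  As [u^2 = o(n)], that
    term is in turn the Poisson weight [exp(-nu) nu^m / m!] up to a factor
    [1 + o(1)] ([binomial_tail_poisson], [local_level_poisson]).

    What remains is an expansion of [nu].  The critical value is the point where
    the standardized binomial deviation equals [d], so [nu] is a root of
    [(nu - m)^2 = D nu (1 - nu / n)], which can be rewritten as the fixed-point
    relation [nu = D + 2 m - m^2 / nu - D nu / n] ([hc_crit_quadratic]).  The
    choice of [d] gives exactly [D = 2 u + L + L^2 / (8 u)], hence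
    [exp(-D) = pi exp(-2 t) / (u (log n)^2) (1 + o(1))].  Substituting,
      [exp(-nu) nu^m = exp(-D) (2 u / e^2)^m exp(m w) (1 + o(1))]
    with [w = log(nu / (2 u)) + m / nu].  The logarithm contributes
    [(L + 2 m) / (2 u)] and the quotient [m / (2 u)], each up to
    [o((L + 3 m) / (2 u))], and so [w = (L + 3 m) / (2 u) (1 + o(1))]
    ([exponent_asymptotics], [hc_mean_exponent]).  This yields one formula valid
    for all [m] ([local_level_expansion]).  The second claim follows since [m w]
    tends to [0] when [m = o(sqrt u)]; the first one follows by replacing [m!]
    with Stirling's formula, whose relative error must be [O(1 / m)] uniformly
    in [m], since [m] may be bounded, tend to infinity, or oscillate
    ([stirling]). *)

Set Implicit Arguments.
Unset Strict Implicit.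
Unset Printing Implicit Defensive.

Import Order.TTheory GRing.Theory Num.Theory.
Import numFieldNormedType.Exports.

Local Open Scope classical_set_scope.
Local Open Scope ring_scope.

(** * Lower binomial tails and Poisson weights *)

(** A sequence that grows at least geometrically is summed by its last term;
    with ratio [rho] tending to [0] the two are equivalent. *)
Lemma sum_le_last_term (R : realFieldType) (b : nat -> R) (rho : R) (m : nat) :
  0 <= rho -> 0 <= b 0%N -> (forall j, (j < m)%N -> b j <= rho * b j.+1) ->
  (1 - rho) * \sum_(j < m.+1) b j <= b m.
Proof.
move=> rho0 b0; elim: m => [|m IH] hb; first by rewrite big_ord1; nra.
rewrite big_ord_recr/=.
have {}IH := IH (fun j jm => hb j (ltnW jm)).
have := hb m (ltnSn m); lra.
Qed.

Definition binomial_weight (R : nzRingType) (n : nat) (q : R) (k : nat) : R :=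
  'C(n, k)%:R * q ^+ k * (1 - q) ^+ (n - k).

Definition poisson_weight (R : realType) (lam : R) (k : nat) : R :=
  lam ^+ k / k`!%:R * expR (- lam).

Lemma binomial_weight_ge0 (R : realDomainType) (n : nat) (q : R) (k : nat) :
  0 <= q <= 1 -> 0 <= binomial_weight n q k.
Proof.
by move=> /andP[q0 q1]; rewrite !mulr_ge0 ?exprn_ge0// subr_ge0.
Qed.

(** The quotient of consecutive weights is [(j + 1) (1 - q) / ((n - j) q)],
    and [n - j >= n / 2] while [j + 1 <= m]. *)
Lemma binomial_weight_ratio (R : realFieldType) (n m j : nat) (q : R) :
  0 < q <= 1 -> (2 * m <= n)%N -> (j < m)%N ->
  binomial_weight n q j <= 2 * m%:R / (n%:R * q) * binomial_weight n q j.+1.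
Proof.
move=> /andP[q0 q1] mn jm.
set b := binomial_weight n q.
have n0 : 0 < n%:R :> R by rewrite ltr0n; lia.
have b0 k : 0 <= b k by apply: binomial_weight_ge0; rewrite ltW.
have rec : b j * ((n - j)%N%:R * q) = b j.+1 * (j.+1%:R * (1 - q)).
  rewrite /b /binomial_weight (_ : (n - j)%N = (n - j.+1).+1); last lia.
  have /(congr1 (fun k => k%:R : R)) := mul_bin_left n j.
  rewrite !natrM (_ : (n - j)%N = (n - j.+1).+1); last lia.
  move=> H; rewrite !exprS.
  transitivity ((n - j.+1).+1%:R * 'C(n, j)%:R *
    (q * q ^+ j * ((1 - q) * (1 - q) ^+ (n - j.+1)))); first by ring.
  by rewrite -H; ring.
have h1 : n%:R / 2 <= (n - j)%N%:R :> R.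
  have : 2 * m%:R <= n%:R :> R by rewrite -natrM ler_nat.
  have : j%:R <= m%:R :> R by rewrite ler_nat ltnW.
  by rewrite natrB; [lra|lia].
have h2 : j.+1%:R * (1 - q) <= m%:R.
  have : j.+1%:R <= m%:R :> R by rewrite ler_nat.
  have : 0 <= j.+1%:R :> R by [].
  nra.
rewrite mulrAC ler_pdivlMr ?mulr_gt0//.
apply: (@le_trans _ _ (2 * (b j * ((n - j)%N%:R * q)))).
  have := b0 j; set B := b j => B0.
  suff : 0 <= B * q * ((n - j)%N%:R - n%:R / 2) by lra.
  by rewrite mulr_ge0 ?subr_ge0// mulr_ge0// ltW.
by rewrite rec; have := ler_wpM2l (b0 j.+1) h2; lra.
Qed.

Lemma bernoulli_ineq (R : realDomainType) (x : R) (m : nat) :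
  0 <= x <= 1 -> 1 - m%:R * x <= (1 - x) ^+ m.
Proof.
move=> /andP[x0 x1]; elim: m => [|m IH]; first by rewrite mul0r subr0.
rewrite exprS -natr1.
have : (1 - x) * (1 - m%:R * x) <= (1 - x) * (1 - x) ^+ m.
  by rewrite ler_wpM2l// subr_ge0.
have : 0 <= m%:R * x * x by rewrite !mulr_ge0.
lra.
Qed.

Lemma ffact_bounds (R : realFieldType) (n m : nat) : (m <= n)%N -> (0 < n)%N ->
  ((1 - m%:R ^+ 2 / n%:R) * n%:R ^+ m <= (n ^_ m)%:R :> R) /\
  ((n ^_ m)%:R <= n%:R ^+ m :> R).
Proof.
move=> mn n0; have n0' : 0 < n%:R :> R by rewrite ltr0n.
split; last first.
  rewrite -natrX ler_nat ffact_prod -[m in (n ^ m)%N]card_ord -prod_nat_const.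
  by apply: leq_prod => j _; exact: leq_subr.
apply: (@le_trans _ _ ((n - m) ^ m)%N%:R); last first.
  rewrite ler_nat ffact_prod -[m in (_ ^ m)%N]card_ord -prod_nat_const.
  by apply: leq_prod => j _; apply: leq_sub2l; apply: ltnW.
rewrite natrX natrB// (_ : n%:R - m%:R = n%:R * (1 - m%:R / n%:R) :> R); last first.
  by rewrite mulrBr mulr1 mulrCA divff ?mulr1// gt_eqF.
rewrite exprMn mulrC ler_wpM2l ?exprn_ge0//.
rewrite expr2 -mulrA; apply: bernoulli_ineq.
by rewrite divr_ge0//= ler_pdivrMr// mul1r ler_nat.
Qed.

(** The falling factorial in the binomial coefficient costs a factor at least
    [1 - m^2 / n], and [(1 - q)^(n - m)] is compared with [exp(- n q)] through
    [exp(- q - 2 q^2) <= 1 - q <= exp(- q)], valid for [q <= 1 / 2]. *)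
Lemma binomial_term_poisson (R : realType) (n m : nat) (q : R) :
  0 <= q <= 1 / 2 -> (m <= n)%N -> (0 < n)%N ->
  let p := poisson_weight (n%:R * q) m in
  ((1 - m%:R ^+ 2 / n%:R) * expR (- 2 * (n%:R * q ^+ 2)) * p
    <= binomial_weight n q m) /\
  (binomial_weight n q m <= expR (m%:R * q) * p).
Proof.
move=> /andP[q0 q2] mn n0 p.
set b := binomial_weight n q m.
have f0 : 0 < m`!%:R :> R by rewrite ltr0n fact_gt0.
have bE : b = (n ^_ m)%:R * (q ^+ m / m`!%:R) * (1 - q) ^+ (n - m).
  rewrite /b /binomial_weight -bin_ffact natrM; congr (_ * _).
  by rewrite -!mulrA; congr (_ * _); rewrite mulrCA divff ?mulr1// gt_eqF.
have pE : p = n%:R ^+ m * (q ^+ m / m`!%:R) * expR (- (n%:R * q)).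
  by rewrite /p /poisson_weight exprMn !mulrA.
have [fl fu] := @ffact_bounds R n m mn n0.
have qm0 : 0 <= q ^+ m / m`!%:R by rewrite divr_ge0 ?exprn_ge0// ltW.
have q10 : 0 < 1 - q by lra.
have lo : expR (- 2 * (n%:R * q ^+ 2)) * expR (- (n%:R * q)) <= (1 - q) ^+ (n - m).
  apply: (@le_trans _ _ ((1 - q) ^+ n)); last first.
    by apply: ler_wiXn2l; [rewrite ltW|lra|exact: leq_subr].
  rewrite -expRD (_ : - 2 * (n%:R * q ^+ 2) + - (n%:R * q) =
    n%:R * (- (q + 2 * q ^+ 2))); last by ring.
  rewrite expRM_natl; apply: lerXn2r; rewrite ?nnegrE ?expR_ge0 ?(ltW q10)//.
  rewrite expRN -[leLHS]div1r ler_pdivrMr ?expR_gt0//.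
  apply: (@le_trans _ _ ((1 - q) * (1 + (q + 2 * q ^+ 2)))); last first.
    by rewrite ler_wpM2l ?expR_ge1Dx// ltW.
  have : 0 <= q ^+ 2 * (1 - 2 * q) by rewrite mulr_ge0 ?sqr_ge0//; lra.
  lra.
have up : (1 - q) ^+ (n - m) <= expR (m%:R * q) * expR (- (n%:R * q)).
  rewrite -expRD (_ : m%:R * q + - (n%:R * q) = (n - m)%N%:R * (- q)); last by rewrite natrB//; ring.
  rewrite expRM_natl; apply: lerXn2r; rewrite ?nnegrE ?expR_ge0 ?(ltW q10)//.
  exact: expR_ge1Dx.
rewrite bE pE; split.
  have [neg|pos] := leP (1 - m%:R ^+ 2 / n%:R) (0 : R).
    apply: (@le_trans _ _ 0); last first.
      by rewrite !mulr_ge0// ?exprn_ge0// ltW.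
    by rewrite -mulrA mulr_le0_ge0// !mulr_ge0 ?expR_ge0 ?exprn_ge0.
  rewrite (_ : _ * _ = ((1 - m%:R ^+ 2 / n%:R) * n%:R ^+ m) * (q ^+ m / m`!%:R) *
     (expR (- 2 * (n%:R * q ^+ 2)) * expR (- (n%:R * q)))); last by ring.
  by rewrite ler_pM ?mulr_ge0 ?expR_ge0 ?exprn_ge0 ?ler_wpM2r// ltW.
rewrite (_ : expR _ * _ = n%:R ^+ m * (q ^+ m / m`!%:R) *
    (expR (m%:R * q) * expR (- (n%:R * q)))); last by ring.
by rewrite ler_pM ?mulr_ge0 ?exprn_ge0 ?ler_wpM2r// ltW.
Qed.

Lemma binomial_tail_poisson (R : realType) (n m : nat) (q : R) :
  0 < q <= 1 / 2 -> (2 * m <= n)%N -> (0 < n)%N ->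
  let S := \sum_(j < m.+1) binomial_weight n q j in
  let p := poisson_weight (n%:R * q) m in
  ((1 - m%:R ^+ 2 / n%:R) * expR (- 2 * (n%:R * q ^+ 2)) * p <= S) /\
  ((1 - 2 * m%:R / (n%:R * q)) * S <= expR (m%:R * q) * p).
Proof.
move=> /andP[q0 q2] mn n0 S p.
have q01 : 0 <= q <= 1 by apply/andP; lra.
have [lo up] : ((1 - m%:R ^+ 2 / n%:R) * expR (- 2 * (n%:R * q ^+ 2)) * p
    <= binomial_weight n q m) /\ (binomial_weight n q m <= expR (m%:R * q) * p).
  by apply: binomial_term_poisson => //; [rewrite ltW | lia].
split.
  apply: le_trans lo _; rewrite /S big_ord_recr/= lerDr.
  by apply: sumr_ge0 => j _; exact: binomial_weight_ge0.
apply: le_trans up; apply: sum_le_last_term => [||j jm].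
- by rewrite divr_ge0 ?mulr_ge0// ltW.
- exact: binomial_weight_ge0.
- by apply: binomial_weight_ratio => //; rewrite q0; lra.
Qed.

(** * Order statistics of independent uniform variables *)

Lemma order_stat_ltE (R : realType) (T : Type) (n : nat) (U : 'I_n -> T -> R)
    (i : nat) (x : T) (h : R) : (1 <= i <= n)%N ->
  (order_stat U i x < h) = (i <= #|[set k | (U k x < h)%R]%SET|)%N.
Proof.
move=> /andP[i0 i_le]; set s := [seq U k x | k <- enum 'I_n].
have sz : size (sort <=%R s) = n by rewrite size_sort size_map size_enum_ord.
have cE : count (< h)%O (sort <=%R s) = #|[set k | (U k x < h)%R]%SET|.
  rewrite count_sort count_map enumT cardE /enum_mem size_filter.
  by apply: eq_count => k; rewrite /= inE.
rewrite -cE /order_stat -/s.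
have so := sort_le_sorted s.
have [lt|ge] := leqP i (count _ _).
  by apply: nth_count_lt => //; rewrite prednK.
apply/negbTE; rewrite -leNgt; apply: nth_count_ge => //.
by rewrite sz prednK// -ltnS prednK// ge i_le.
Qed.

Lemma uniform_prob_lt (R : realType) (h : R) : 0 <= h <= 1 ->
  uniform_prob (@ltr01 R) `]-oo, h[ = h%:E.
Proof.
move=> /andP[h0 h1]; rewrite /uniform_prob integral_uniform_pdf.
have -> : (`]-oo, h[ `&` `[0, 1] = `[0, h[)%classic.
  apply/seteqP; split => x /=; rewrite !in_itv/=.
    by move=> [-> /andP[-> _]].
  by move=> /andP[x0 xh]; split => //; rewrite x0 ltW// (lt_le_trans xh).
rewrite (eq_integral (cst 1%E)); last first.
  move=> x; rewrite inE/= in_itv/= /uniform_pdf => /andP[x0 xh].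
  by rewrite x0 ltW ?(lt_le_trans xh)// subr0 invr1.
rewrite integral_cst//= mul1e lebesgue_measure_itv/= lte_fin.
by case: ifPn; rewrite ?oppr0 ?adde0// -leNgt => hle; congr EFin; apply/le_anti/andP.
Qed.

(** Prescribing which variables fall below [h] is an event of product form, so
    independence applies with one half-line or its complement for each
    variable. *)
Lemma below_probability (R : realType) (d : measure_display)
    (T : measurableType d) (P : probability T R) (n : nat)
    (U : 'I_n -> {RV P >-> R}) (h : R) (J : {set 'I_n}) :
  iid_uniform U -> 0 <= h <= 1 ->
  let E := [set x | [set k | (U k x < h)%R]%SET = J] in
  measurable E /\ P E = (h ^+ #|J| * (1 - h) ^+ (n - #|J|))%:E.
Proof.
move=> [indU unifU] h01 E.
pose B k : set R := if k \in J then [set` `]-oo, h[%R] else ~` [set` `]-oo, h[%R].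
have mB k : measurable (B k).
  by rewrite /B; case: ifP => _; [|apply: measurableC]; exact: measurable_itv.
have EB : E = [set x | forall k, B k (U k x)].
  apply/seteqP; split => x /=.
    by move=> EJ k; rewrite /B -EJ inE; case: ifPn => /=; rewrite in_itv/= // => /negP.
  move=> Bx; apply/setP => k; rewrite inE.
  move: (Bx k); rewrite /B; case: ifPn => _ /=; rewrite in_itv/= //.
  by move=> /negP/negbTE.
have mUB k : measurable (U k @^-1` B k) by rewrite -[X in measurable X]setTI; exact: measurable_funPT.
split.
  rewrite EB (_ : [set x | _] = \bigcap_(k in [set: 'I_n]) (U k @^-1` B k)); last first.
    by apply/seteqP; split => x /= Bx k; [move=> _|]; exact: Bx.
  by apply: fin_bigcap_measurable => //; exact: finite_finset.
rewrite EB indU//.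
have PB k : P (U k @^-1` B k) = (if k \in J then h else 1 - h)%:E.
  have := unifU k _ (mB k); rewrite /distribution/= /pushforward => ->.
  rewrite /B; case: ifPn => _; first exact: uniform_prob_lt.
  rewrite probability_setC; last exact: measurable_itv.
  by rewrite /= uniform_prob_lt.
under eq_bigr do rewrite PB.
rewrite -(big_morph EFin (@EFinM R) (erefl : 1%:E = 1%E)); congr EFin.
rewrite (bigID (mem J))/=; congr (_ * _).
  rewrite (eq_bigr (fun=> h)); first by rewrite prodr_const.
  by move=> k ->.
rewrite (eq_bigr (fun=> 1 - h)); last by move=> k /negbTE ->.
rewrite prodr_const; congr (_ ^+ _).
have := cardC (mem J); rewrite (card_ord n) => CJ.
apply: (@addnI #|J|); rewrite subnKC; first by rewrite -[RHS]CJ.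
by rewrite -[leqRHS]CJ leq_addr.
Qed.

(** The event is the disjoint union, over the sets [J] of at least [i]
    indices, of the events that exactly the variables indexed by [J] fall
    below [h]; grouping by the number [j = n - #|J|] of the others gives
    binomial coefficients. *)
Lemma local_level_binomial (R : realType) (d : measure_display)
    (T : measurableType d) (P : probability T R) (n : nat)
    (U : 'I_n -> {RV P >-> R}) (delta : R) (i : nat) :
  let h := hc_crit i n delta in
  iid_uniform U -> 0 <= h <= 1 -> (1 <= i <= n)%N ->
  local_level U delta i =
    \sum_(j < (n - i).+1) binomial_weight n (1 - h) j.
Proof.
move=> h iidU h01 i_n; rewrite /binomial_weight subKr; rewrite /local_level -/h.
pose E (J : {set 'I_n}) := [set x | [set k | (U k x < h)%R]%SET = J].
pose D := [set J : {set 'I_n} | (i <= #|J|)%N].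
have -> : [set x | order_stat (fun k => U k : T -> R) i x < h] =
          \bigcup_(J in D) E J.
  apply/seteqP; split => x /=; rewrite order_stat_ltE//.
    by move=> ix; exists [set k | (U k x < h)%R]%SET.
  by move=> [J]; rewrite /D/E/= => iJ ->.
rewrite measure_fin_bigcup/=; first last.
- by move=> J _; have [] := below_probability J iidU h01.
- by move=> J1 J2 _ _ [x []]; rewrite /E/= => <- <-.
- exact: finite_finset.
have -> : (\sum_(J \in D) P (E J) =
  (\sum_(J : {set 'I_n} | (i <= #|J|)%N)
     h ^+ #|J| * (1 - h) ^+ (n - #|J|))%:E)%E.
  have -> : D = [set` [seq J : {set 'I_n} <- index_enum _ | (i <= #|J|)%N]].
    by apply/seteqP; split => J /=; rewrite mem_filter mem_index_enum andbT.
  rewrite -fsbig_seq ?filter_uniq ?index_enum_uniq// big_filter -sumEFin.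
  by apply: eq_bigr => J _; have [] := below_probability J iidU h01.
rewrite /=.
have cn (J : {set 'I_n}) : (#|J| <= n)%N by rewrite -[X in (_ <= X)%N]card_ord max_card.
rewrite (partition_big (fun J : {set 'I_n} => inord (n - #|J|) : 'I_(n - i).+1) xpredT)//=.
apply: eq_bigr => j _.
have jn : (j <= n - i)%N by rewrite -ltnS.
rewrite (eq_bigl (fun J : {set 'I_n} => #|J| == (n - j)%N)); last first.
  move=> J; apply/andP/eqP.
    move=> [iJ /eqP <-]; rewrite inordK ?ltnS ?leq_sub2l//.
    by rewrite subKn.
  move=> Jn; rewrite Jn; split; first lia.
  by apply/eqP/val_inj; rewrite /= inordK; lia.
rewrite (eq_bigr (fun=> (1 - h) ^+ j * h ^+ (n - j))); last first.
  by move=> J /eqP ->; rewrite mulrC; congr (_ ^+ _ * _); lia.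
rewrite sumr_const -mulrA [RHS]mulr_natl; congr (_ *+ _).
have -> : 'C(n, j) = 'C(n, n - j) by rewrite bin_sub//; lia.
rewrite -[X in 'C(X, _)](card_ord n) -card_draws.
by apply: eq_card => J; rewrite [RHS]inE.
Qed.

(** * Wallis integrals and logarithmic inequalities *)

Definition wallis (R : realType) (n : nat) : R :=
  (\int[lebesgue_measure]_(x in `[0%R, (pi / 2)%R]) (sin x ^+ n))%R.

Lemma integrable_sinX (R : realType) (n : nat) :
  (@lebesgue_measure R).-integrable `[0, (pi / 2)%R]
    (EFin \o (fun x => sin x ^+ n)).
Proof.
apply: continuous_compact_integrable; first exact: segment_compact.
apply: continuous_subspaceT => x.
apply: (@continuous_comp _ _ _ sin (fun y => y ^+ n)); first exact: continuous_sin.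
exact: exprn_continuous.
Qed.

Lemma sin_pihalf_itv (R : realType) (x : R) :
  x \in `[0, pi / 2] -> 0 <= sin x <= 1.
Proof.
rewrite in_itv/= => /andP[x0 xp]; rewrite sin_le1 andbT sin_ge0_pi// x0/=.
by have := pi_ge0 R; lra.
Qed.

Lemma wallis_ge0 (R : realType) n : 0 <= wallis R n.
Proof.
apply: Rintegral_ge0 => x /= /sin_pihalf_itv/andP[s0 _].
exact: exprn_ge0.
Qed.

Lemma wallis_anti (R : realType) n : wallis R n.+1 <= wallis R n.
Proof.
apply: le_Rintegral => //; [exact: integrable_sinX..|].
move=> x /= /sin_pihalf_itv/andP[s0 s1].
by rewrite exprS ler_piMl// exprn_ge0.
Qed.

Lemma wallis0 (R : realType) : wallis R 0 = pi / 2.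
Proof.
rewrite /wallis; under eq_Rintegral do rewrite expr0.
rewrite Rintegral_cst//= mul1r lebesgue_measure_itv/= lte_fin.
by rewrite divr_gt0 ?pi_gt0//= subr0.
Qed.

Lemma Rintegral_antiderivative (R : realType) (F f : R -> R) (a b : R) :
  a < b -> (forall x : R, is_derive x 1 F (f x)) -> continuous f ->
  (\int[lebesgue_measure]_(x in `[a, b]) f x)%R = F b - F a.
Proof.
move=> ab dF cf; rewrite /Rintegral (@continuous_FTC2 _ f F)//.
- exact: continuous_subspaceT.
- have cF : continuous F.
    by move=> x; apply: differentiable_continuous; apply/derivable1_diffP.
  split; first by move=> x _; exact: ex_derive.
  + exact/cvg_at_right_filter/cF.
  + exact/cvg_at_left_filter/cF.
- by move=> x _; rewrite derive1E derive_val.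
Qed.

Lemma wallis1 (R : realType) : wallis R 1 = 1.
Proof.
have dcos (x : R) : is_derive x 1 (fun y => - cos y) (sin x ^+ 1).
  by apply: is_derive_eq; rewrite opprK expr1.
have csin : continuous (fun x : R => sin x ^+ 1) by exact: continuous_sin.
rewrite /wallis (Rintegral_antiderivative _ dcos csin) ?divr_gt0 ?pi_gt0//.
by rewrite cos_pihalf cos0; lra.
Qed.

(** [- sin^(n+1) cos] is an antiderivative of [(n + 2) sin^(n+2) - (n + 1)
    sin^n] and vanishes at both ends of the interval. *)
Lemma wallis_rec (R : realType) n :
  n.+2%:R * wallis R n.+2 = n.+1%:R * wallis R n.
Proof.
have cX k : continuous (fun x : R => k.+2%:R * sin x ^+ k.+2 - k.+1%:R * sin x ^+ k).
  move=> x; apply: cvgB; apply: cvgM; try exact: cvg_cst.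
  - apply: (@continuous_comp _ _ _ sin (fun y => y ^+ k.+2)); first exact: continuous_sin.
    exact: exprn_continuous.
  - apply: (@continuous_comp _ _ _ sin (fun y => y ^+ k)); first exact: continuous_sin.
    exact: exprn_continuous.
have dF (x : R) : is_derive x 1 (- ((@sin R) ^+ n.+1 * (@cos R)))
    (n.+2%:R * sin x ^+ n.+2 - n.+1%:R * sin x ^+ n).
  apply: is_derive_eq; rewrite /GRing.scale/=.
  rewrite !fctE; set X := sin x ^+ n.
  transitivity (sin x ^+ 2 * X - n.+1%:R * X * cos x ^+ 2).
    by rewrite exprS -/X; ring.
  have -> : sin x ^+ n.+2 = sin x ^+ 2 * X by rewrite -exprD.
  rewrite cos2sin2 -(natr1 n.+1); ring.
have piP : 0 < pi / 2 :> R by rewrite divr_gt0 ?pi_gt0.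
have intZ (c : R) k : (@lebesgue_measure R).-integrable `[0, (pi / 2)%R]
    (EFin \o (fun x => c * sin x ^+ k)).
  by have := integrableZl _ c (integrable_sinX R k); rewrite /comp/=; exact.
have := Rintegral_antiderivative piP dF (cX n).
rewrite !fctE sin0 cos_pihalf expr0n/= mul0r mulr0 subrr.
rewrite RintegralB//=; [|exact: intZ..].
rewrite !RintegralZl//; [|exact: integrable_sinX..].
by move/eqP; rewrite subr_eq0 => /eqP.
Qed.

Lemma ge0_is_derive_le (R : realType) (f df : R -> R) (a y : R) :
  (forall x : R, a <= x -> is_derive x 1 f (df x)) ->
  (forall x : R, a <= x -> 0 <= df x) -> a <= y -> f a <= f y.
Proof.
move=> dfE df0 ay.
have dI (x : R) : x \in `]a, y[ -> is_derive x 1 f (df x).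
  by rewrite in_itv/= => /andP[/ltW ax _]; exact: dfE.
have cI : {within `[a, y], continuous f}.
  apply: continuous_in_subspaceT => x; rewrite inE/= in_itv/= => /andP[ax _].
  apply: differentiable_continuous; apply/derivable1_diffP.
  by have [] := dfE _ ax.
have [c] := MVT_segment ay dI cI.
rewrite in_itv/= => /andP[ac _] H.
by rewrite -subr_ge0 H mulr_ge0 ?df0 ?subr_ge0.
Qed.

Lemma is_derive_inv (R : realType) (x : R) : 0 < x ->
  is_derive x 1 (fun z : R => z^-1) (- x ^- 2).
Proof.
move=> x0; have xn0 : x != 0 by rewrite gt_eqF.
have H := @is_deriveV R id x 1 1 xn0 (is_derive_id x 1).
by apply: (is_derive_eq H); rewrite /GRing.scale/= mulr1.
Qed.

(** The right-hand side is the trapezoid approximation of the logarithm as the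
    integral of [1 / x], a convex function. The two bounds on the logarithm
    given here agree to second order at [1], which is the precision that makes
    the increments in Stirling's formula summable. *)
Lemma ln_le_trapezoid (R : realType) (y : R) : 1 <= y -> ln y <= (y - y^-1) / 2.
Proof.
move=> y1; pose g : R -> R := 2^-1 *: (id - (fun z : R => z^-1)) - @ln R.
have dg (x : R) : 1 <= x -> is_derive x 1 g ((1 - x^-1) ^+ 2 / 2).
  move=> x1; have x0 : 0 < x by rewrite (lt_le_trans _ x1).
  have lnx := is_derive1_ln x0; have invx := is_derive_inv x0.
  apply: is_derive_eq; rewrite /GRing.scale/=.
  by field; rewrite gt_eqF.
have := ge0_is_derive_le dg _ y1.
rewrite /g !fctE ln1 invr1 subrr scaler0 subrr /GRing.scale/= => H.
suff : 0 <= 2^-1 * (y - y^-1) - ln y by lra.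
by apply: H => x x1; rewrite divr_ge0 ?sqr_ge0.
Qed.

(** The left-hand side is the midpoint approximation of the same integral,
    which convexity makes a lower bound. *)
Lemma ln_ge_midpoint (R : realType) (y : R) : 1 <= y ->
  2 * (y - 1) / (y + 1) <= ln y.
Proof.
move=> y1; pose g : R -> R := @ln R + 4 *: (fun z : R => (z + 1)^-1).
have dg (x : R) : 1 <= x -> is_derive x 1 g ((x - 1) ^+ 2 / (x * (x + 1) ^+ 2)).
  move=> x1; have x0 : 0 < x by rewrite (lt_le_trans _ x1).
  have x10 : x + 1 != 0 by rewrite gt_eqF// addr_gt0.
  have lnx := is_derive1_ln x0.
  have invx : is_derive x 1 (fun z : R => (z + 1)^-1) (- (x + 1) ^- 2).
    have H1 : is_derive x 1 (id + cst 1) (1 : R) by apply: is_derive_eq; rewrite addr0.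
    have H := @is_deriveV R (id + cst 1) x 1 1 x10 H1.
    by apply: (is_derive_eq H); rewrite /GRing.scale/= mulr1.
  have H := is_deriveD lnx (is_deriveZ 4 invx).
  apply: (is_derive_eq H); rewrite /GRing.scale/=.
  by field; rewrite ?x10 ?gt_eqF.
have := ge0_is_derive_le dg _ y1.
rewrite /g !fctE ln1 /GRing.scale/= => H.
have {}H : 0 + 4 * (1 + 1)^-1 <= ln y + 4 * (y + 1)^-1 :> R.
  apply: H => x x1; rewrite divr_ge0 ?sqr_ge0// mulr_ge0 ?sqr_ge0//; lra.
have -> : 2 * (y - 1) / (y + 1) = 2 - 4 * (y + 1)^-1 by field; lra.
have E2 : 4 * (1 + 1)^-1 = 2 :> R by field.
by move: H; rewrite E2; lra.
Qed.

(** * The Wallis product and Stirling's formula with an error bound *)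

(** The recurrence makes the left-hand side independent of [n]. *)
Lemma wallis_prod (R : realType) n : n.+1%:R * (wallis R n * wallis R n.+1) = pi / 2.
Proof.
elim: n => [|n IH]; first by rewrite wallis0 wallis1; ring.
by rewrite -IH; have := wallis_rec R n; set a := wallis R n.+2 => H; rewrite mulrCA H; ring.
Qed.

(** Monotonicity of the Wallis integrals allows one of the two factors of
    [wallis_prod] to be replaced by its neighbour; this is where the constant
    [pi] of Stirling's formula comes from. *)
Lemma wallis_bounds (R : realType) k :
  (pi / 2 <= (2 * k).+1%:R * wallis R (2 * k) ^+ 2) /\
  ((2 * k)%:R * wallis R (2 * k) ^+ 2 <= pi / 2).
Proof.
split.
  rewrite -(wallis_prod R (2 * k)) ler_wpM2l// expr2 ler_wpM2l ?wallis_ge0//.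
  exact: wallis_anti.
case: k => [|k]; first by rewrite muln0 mul0r divr_ge0 ?pi_ge0.
rewrite mulnS -(wallis_prod R (2 * k).+1) ler_wpM2l// expr2 ler_wpM2r ?wallis_ge0//.
exact: wallis_anti.
Qed.

Lemma wallis_even (R : realType) k :
  wallis R (2 * k) * (k`!%:R ^+ 2 * 4 ^+ k) = (2 * k)`!%:R * (pi / 2).
Proof.
elim: k => [|k IH]; first by rewrite muln0 wallis0 fact0; ring.
have e : (2 * k.+1 = (2 * k).+2)%N by lia.
rewrite e !factS !natrM.
transitivity ((2 * k).+1%:R * (2 * k).+2%:R * ((2 * k)`!%:R * (pi / 2)) : R); last by ring.
rewrite -IH.
have E2 : (2 * k).+2%:R = 2 * k.+1%:R :> R by rewrite -natrM e.
have := wallis_rec R (2 * k); rewrite E2 => H.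
transitivity (2 * k.+1%:R * wallis R (2 * k).+2 * (2 * k.+1%:R * k`!%:R ^+ 2 * 4 ^+ k)).
  by rewrite (exprS 4); ring.
by rewrite H; ring.
Qed.

(** Stirling's formula says that this tends to [ln (2 pi) / 2]. *)
Definition stirling_defect (R : realType) (k : nat) : R :=
  ln k`!%:R - (k%:R + 1 / 2) * ln k%:R + k%:R.

(** The difference is [(k + 1/2) ln ((k + 1) / k) - 1], and the two bounds on
    the logarithm at [(k + 1) / k] give exactly the two sides. *)
Lemma stirling_defect_step (R : realType) k : (0 < k)%N ->
  0 <= stirling_defect R k - stirling_defect R k.+1
    <= (k%:R^-1 - k.+1%:R^-1) / 4.
Proof.
move=> k0; have K0 : 0 < k%:R :> R by rewrite ltr0n.
have F0 : 0 < k`!%:R :> R by rewrite ltr0n fact_gt0.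
set K : R := k%:R in K0 *; have K1 : k.+1%:R = K + 1 :> R by rewrite -natr1.
have K10 : 0 < K + 1 by lra.
pose y := (K + 1) / K.
have y1 : 1 <= y by rewrite /y ler_pdivlMr//; lra.
have lny : ln y = ln (K + 1) - ln K by rewrite /y ln_div ?posrE.
have -> : stirling_defect R k - stirling_defect R k.+1 = (K + 1 / 2) * ln y - 1.
  rewrite /stirling_defect factS natrM lnM ?posrE// ?ltr0n// K1 lny -/K; ring.
have e1 : 2 * (y - 1) / (y + 1) = (K + 1 / 2)^-1.
  by rewrite /y; field; lra.
have e2 : (y - y^-1) / 2 = (K + 1 / 2) / (K * (K + 1)).
  by rewrite /y; field; lra.
have := ln_ge_midpoint y1; rewrite e1; have := ln_le_trapezoid y1; rewrite e2.
have Kh : 0 < K + 1 / 2 by lra.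
rewrite -(ler_pM2l Kh) => up; rewrite -(ler_pM2l Kh) divff ?gt_eqF// => lo.
rewrite K1; apply/andP; split; first lra.
have -> : (K^-1 - (K + 1)^-1) / 4 = (K + 1 / 2) * ((K + 1 / 2) / (K * (K + 1))) - 1.
  by field; lra.
lra.
Qed.

Lemma stirling_defect_telescope (R : realType) k j : (0 < k)%N ->
  0 <= stirling_defect R k - stirling_defect R (k + j)
    <= (k%:R^-1 - (k + j)%:R^-1) / 4.
Proof.
move=> k0; elim: j => [|j /andP[lo up]]; first by rewrite addn0 !subrr mul0r lexx.
have /andP[lo' up'] := @stirling_defect_step R (k + j) (ltn_addr j k0).
rewrite addnS; move: lo up lo' up'.
set a := (k + j)%:R^-1; set b := (k + j).+1%:R^-1.
by move=> lo up lo' up'; apply/andP; split; lra.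
Qed.

(** In this combination all the factorials come together in the central
    binomial coefficient, which an even Wallis integral evaluates. *)
Lemma stirling_defect_double (R : realType) k : (0 < k)%N ->
  ln (2 * pi) / 2 <= 2 * stirling_defect R k - stirling_defect R (2 * k)
    <= ln (2 * pi) / 2 + k%:R^-1 / 4.
Proof.
move=> k0; have K0 : 0 < k%:R :> R by rewrite ltr0n.
have F0 : 0 < k`!%:R :> R by rewrite ltr0n fact_gt0.
have F20 : 0 < (2 * k)`!%:R :> R by rewrite ltr0n fact_gt0.
have P0 := pi_gt0 R.
have [lo up] := wallis_bounds R k; have ev := wallis_even R k.
set W := wallis R (2 * k) in lo up ev.
have W0 : 0 < W.
  rewrite lt_neqAle wallis_ge0 andbT; apply/eqP => W0; move: lo.
  by rewrite -/W -W0 expr0n mulr0; lra.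
have lnW : ln W = ln (2 * k)`!%:R + (ln pi - ln 2) - 2 * ln k`!%:R - 2 * k%:R * ln 2.
  have := congr1 (@ln R) ev.
  rewrite !lnM ?posrE ?mulr_gt0 ?exprn_gt0 ?invr_gt0 ?divr_gt0// !lnXn// lnV ?posrE//.
  have ln4 : ln 4 = 2 * ln 2 :> R.
    by rewrite (_ : 4 = 2 ^+ 2) ?lnXn ?mulr_natl// -natrX.
  rewrite ln4 -[_ *+ k]mulr_natl => H.
  lra.
have ln2k : ln (2 * k)%:R = ln 2 + ln k%:R :> R by rewrite natrM lnM ?posrE.
have -> : 2 * stirling_defect R k - stirling_defect R (2 * k) =
   ln pi - ln 2 / 2 - ln W - ln k%:R / 2.
  by rewrite /stirling_defect lnW ln2k natrM; field.
have lo' : ln pi - ln 2 <= ln (2 * k).+1%:R + 2 * ln W.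
  move: lo; rewrite -ler_ln ?posrE ?mulr_gt0 ?divr_gt0 ?exprn_gt0//.
  by rewrite !lnM ?lnXn ?lnV ?posrE ?invr_gt0 ?exprn_gt0// mulr_natl.
have up' : ln 2 + ln k%:R + 2 * ln W <= ln pi - ln 2.
  move: up; rewrite -ler_ln ?posrE ?mulr_gt0 ?divr_gt0 ?exprn_gt0 ?ltr0n ?muln_gt0//.
  rewrite !lnM ?lnXn ?lnV ?posrE ?invr_gt0 ?exprn_gt0 ?ltr0n ?muln_gt0//.
  by rewrite ln2k mulr_natl.
have l21 : ln (2 * k).+1%:R <= ln 2 + ln k%:R + k%:R^-1 / 2 :> R.
  rewrite -ln2k -lerBlDl -ln_div ?posrE ?ltr0n ?muln_gt0//.
  rewrite (_ : (2 * k).+1%:R / (2 * k)%:R = 1 + k%:R^-1 / 2 :> R); last first.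
    by rewrite -natr1 natrM; field; rewrite gt_eqF.
  by apply: le_ln1Dx; rewrite (@lt_trans _ _ 0)// divr_gt0 ?invr_gt0.
rewrite lnM ?posrE//; apply/andP; split; lra.
Qed.

(** The defect at [k] is the combination of the previous lemma minus its
    change between [k] and [2 k]; both are known up to [1 / (4 k)], with
    errors of opposite signs. *)
Lemma stirling_defect_bound (R : realType) k : (0 < k)%N ->
  `|stirling_defect R k - ln (2 * pi) / 2| <= k%:R^-1 / 4.
Proof.
move=> k0; have /andP[l1 u1] := @stirling_defect_double R k k0.
have /andP[l2 u2] := @stirling_defect_telescope R k k k0.
rewrite addnn -mul2n in l2 u2.
have : 0 <= (2 * k)%:R^-1 :> R by rewrite invr_ge0.
by move=> h; rewrite ler_norml; apply/andP; split; lra.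
Qed.

Lemma stirling (R : realType) : exists A : nat -> R,
  (forall m, (0 < m)%N -> `|A m| <= expR 1 / m%:R) /\
  (forall m, (0 < m)%N ->
     1 / m`!%:R = (expR 1 / m%:R) ^+ m / Num.sqrt (2 * pi * m%:R) * (1 + A m)).
Proof.
pose th (m : nat) : R := ln (2 * pi) / 2 - stirling_defect R m.
exists (fun m => expR (th m) - 1); split => m m0.
  have M0 : 0 < m%:R :> R by rewrite ltr0n.
  have /= := @stirling_defect_bound R m m0.
  rewrite distrC -/(th m); set x := th m => xm.
  have M1 : m%:R^-1 <= 1 :> R by rewrite invf_le1// ler1n.
  have Mi : 0 < m%:R^-1 :> R by rewrite invr_gt0.
  move: xm; rewrite ler_norml => /andP[xl xu].
  have e1 := expR_ge1Dx x.
  (* This is 1 - x <= expR (- x), multiplied by expR x. *)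
  have e2 : expR x - 1 <= x * expR x.
    have := expR_ge1Dx (- x); rewrite expRN.
    move=> h; have X0 := expR_gt0 x.
    have := ler_wpM2l (ltW X0) h; rewrite divff ?gt_eqF//; lra.
  have e3 : expR x <= expR 1 by rewrite ler_expR; lra.
  have e4 := expR_ge1Dx (1 : R).
  have e5 := expR_gt0 x.
  rewrite ler_norml; apply/andP; split.
    have : m%:R^-1 <= expR 1 / m%:R :> R by rewrite ler_peMl ?invr_ge0//; lra.
    lra.
  have [x0|x0] := leP 0 x; last first.
    have : 0 <= expR 1 / m%:R :> R by rewrite divr_ge0 ?expR_ge0.
    have : x * expR x <= 0 by rewrite mulr_le0_ge0 ?expR_ge0// ltW.
    lra.
  have : x * expR x <= m%:R^-1 * expR 1 by rewrite ler_pM ?expR_ge0//; lra.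
  lra.
have M0 : 0 < m%:R :> R by rewrite ltr0n.
have F0 : 0 < m`!%:R :> R by rewrite ltr0n fact_gt0.
have P0 := pi_gt0 R.
rewrite addrC subrK.
have sq : Num.sqrt (2 * pi * m%:R) = expR ((ln (2 * pi) + ln m%:R) / 2) :> R.
  have -> : 2 * pi * m%:R = expR ((ln (2 * pi) + ln m%:R) / 2) ^+ 2 :> R.
    rewrite -expRM_natl mulrCA divff// mulr1 expRD !lnK ?posrE ?mulr_gt0//.
  by rewrite sqrtr_sqr ger0_norm ?expR_ge0.
rewrite sq -expRN exprMn -expRM_natl mulr1 exprVn.
have -> : (m%:R ^+ m)^-1 = expR (- (m%:R * ln m%:R)) :> R.
  by rewrite expRN expRM_natl lnK ?posrE.
rewrite div1r -[m`!%:R]lnK ?posrE// -expRN -!expRD; congr expR.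
by rewrite /th /stirling_defect; field.
Qed.

(** * The equation of the critical value *)

(** The number [nu] is the larger root of [(1 + D / n) nu^2 - (D + 2 M) nu +
    M^2 = 0]; dividing by [nu] gives the last relation. The bounds compare [d]
    times the square root in the formula with [D], with [D + 2 M], and, for
    the sign of the critical value, with [D + 2 i]. *)
Lemma hc_crit_quadratic (R : realType) (n i : nat) (d : R) :
  (0 < n)%N -> (i <= n)%N -> 0 < d ->
  let D := d ^+ 2 in let M : R := (n - i)%N%:R in
  let nu := n%:R * (1 - hc_crit i n d) in
  [/\ 0 <= hc_crit i n d,
      D <= nu * (1 + D / n%:R),
      nu <= D + 2 * M &
      nu = D + 2 * M - M ^+ 2 / nu - D * nu / n%:R].
Proof.
move=> n0 i_n d0 D M nu.
have N0 : 0 < n%:R :> R by rewrite ltr0n.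
set N : R := n%:R in N0 *; set h := hc_crit i n d in nu *.
have iE : i%:R = N - M :> R by rewrite /M natrB//; ring.
have M0 : 0 <= M by [].
have MN : M <= N by rewrite ler_nat leq_subr.
have D0 : 0 < D by rewrite exprn_gt0.
set S := Num.sqrt (d ^+ 2 + 4 * i%:R - 4 * i%:R ^+ 2 / N).
have SE : d ^+ 2 + 4 * i%:R - 4 * i%:R ^+ 2 / N = D + 4 * (M * (N - M) / N).
  by rewrite iE -/D; field; rewrite gt_eqF.
have X0 : 0 <= M * (N - M) / N by rewrite divr_ge0 ?mulr_ge0 ?subr_ge0// ltW.
have S2 : S ^+ 2 = D + 4 * (M * (N - M) / N).
  by rewrite /S SE sqr_sqrtr//; lra.
have S0 : 0 <= S by exact: sqrtr_ge0.
have DN0 : 0 < D + N by rewrite addr_gt0.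
have hE : h = (D + 2 * (N - M) - d * S) / (2 * (D + N)).
  by rewrite /h /hc_crit -/N -/S iE.
have dS2 : (d * S) ^+ 2 = D * (D + 4 * (M * (N - M) / N)) by rewrite exprMn S2.
have dS0 : 0 <= d * S by rewrite mulr_ge0// ltW.
have XE : M * (N - M) / N = M - M ^+ 2 / N by field; rewrite gt_eqF.
have Y0 : 0 <= M ^+ 2 / N by rewrite divr_ge0 ?sqr_ge0// ltW.
(* The square of d S is D^2 + 4 D M (n - M) / n, and the three comparisons
   that follow are between squares. *)
have dSD : D <= d * S.
  rewrite -(@ler_pXn2r _ 2)// ?nnegrE ?(ltW D0)// dS2 expr2 ler_pM2l//; lra.
have dSu : d * S <= D + 2 * M.
  rewrite -(@ler_pXn2r _ 2)// ?nnegrE//; last by lra.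
  rewrite dS2 XE.
  have : 0 <= D * (M ^+ 2 / N) by rewrite mulr_ge0// ltW.
  have : 0 <= M ^+ 2 by rewrite sqr_ge0.
  by move=> h1 h2; rewrite -subr_ge0 (_ : _ - _ = 4 * M ^+ 2 + 4 * (D * (M ^+ 2 / N))); [lra|ring].
have dSu' : d * S <= D + 2 * (N - M).
  rewrite -(@ler_pXn2r _ 2)// ?nnegrE//; last by lra.
  rewrite dS2.
  rewrite -subr_ge0 (_ : _ - _ = 4 * (N - M) ^+ 2 * (D + N) / N); last first.
    by field; rewrite gt_eqF.
  apply: divr_ge0; last exact: ltW.
  by apply: mulr_ge0; [rewrite mulr_ge0 ?sqr_ge0 | exact: ltW].
have nuE : nu * (1 + D / N) = (D + 2 * M + d * S) / 2.
  by rewrite /nu hE; field; rewrite !gt_eqF.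
have E1 : 1 <= 1 + D / N by rewrite lerDl divr_ge0// ltW.
have nu0 : 0 < nu.
  by rewrite -(pmulr_lgt0 _ (lt_le_trans ltr01 E1)) nuE; lra.
split.
- by rewrite hE divr_ge0 ?subr_ge0// mulr_ge0// ltW.
- by rewrite nuE; lra.
- apply: (@le_trans _ _ (nu * (1 + D / N))); last by rewrite nuE; lra.
  by rewrite ler_peMr// ltW.
- have : nu * (nu * (1 + D / N)) = nu * (D + 2 * M) - M ^+ 2.
    apply: (@mulIf _ (1 + D / N)); first by rewrite gt_eqF// (lt_le_trans ltr01).
    transitivity ((nu * (1 + D / N)) ^+ 2); first by ring.
    transitivity (nu * (1 + D / N) * (D + 2 * M) - M ^+ 2 * (1 + D / N)); last by ring.
    rewrite nuE.
    have -> : ((D + 2 * M + d * S) / 2) ^+ 2 =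
        ((D + 2 * M) ^+ 2 + 2 * (D + 2 * M) * (d * S) + (d * S) ^+ 2) / 4 by field.
    by rewrite dS2; field; rewrite gt_eqF.
  move=> quad; apply: (@mulfI _ nu); first by rewrite gt_eqF.
  transitivity (nu * (nu * (1 + D / N)) - nu * (D * nu / N)); first by ring.
  by rewrite quad; field; rewrite !gt_eqF.
Qed.

(** With [y = nu / (2 u) - 1], the relation for [nu] gives [2 u y = L + dl + 2
    M - M^2 / nu - ep], and [ln (1 + y)] differs from [y] by at most [k y^2].
    The bound is explicit so that it vanishes in the limit uniformly in [M]:
    every error term is either multiplied by [M <= L + 3 M] or absolute and
    hence absorbed by [L >= 1]. *)
Lemma exponent_asymptotics (R : realType) (u L M nu dl ep k : R) :
  0 < u -> 0 < nu -> 1 <= L -> 0 <= M -> 0 <= dl -> 0 <= ep ->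
  nu = 2 * u + L + dl + 2 * M - M ^+ 2 / nu - ep ->
  k = 2 * u / nu ->
  `|(ln (nu / (2 * u)) + M / nu) / ((L + 3 * M) / (2 * u)) - 1| <=
    dl + M / nu + ep + `|k - 1| + k * `|k^-1 - 1| * (2 + dl + M / nu + ep).
Proof.
move=> u0 nu0 L1 M0 dl0 ep0 nuE kE.
have u20 : 0 < 2 * u by rewrite mulr_gt0.
have k0 : 0 < k by rewrite kE divr_gt0.
have kV : k^-1 = nu / (2 * u) by rewrite kE invf_div.
have kV0 : 0 < k^-1 by rewrite invr_gt0.
set y := k^-1 - 1.
rewrite -kV; set a := M / nu.
have a0 : 0 <= a by rewrite divr_ge0// ltW.
set B := L + 3 * M; have B1 : 1 <= B by rewrite /B; lra.
have B0 : 0 < B by lra.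
have yE : 2 * u * y = L + dl + 2 * M - M * a - ep.
  rewrite /y kV mulrBr mulrCA divff ?gt_eqF// !mulr1 {1}nuE /a; ring.
pose g := ln k^-1 - y.
have g_up : g <= 0.
  rewrite subr_le0 -[X in ln X](subrKC 1) -/y; apply: le_ln1Dx; rewrite /y; lra.
have g_lo : - (k * y ^+ 2) <= g.
  have := @le_ln1Dx R (k - 1) _; rewrite (addrC 1) subrK => /(_ _) lk.
  have {}lk : ln k <= k - 1 by apply: lk; lra.
  rewrite /g lnV ?posrE//.
  have : k * y = 1 - k by rewrite /y mulrBr divff ?gt_eqF// mulr1.
  rewrite expr2 mulrA => ->; rewrite mulrBl mul1r; have : k * y = 1 - k by rewrite /y mulrBr divff ?gt_eqF// mulr1.
  lra.
have aE : 2 * u * a = k * M by rewrite /a kE; ring.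
have main : (ln k^-1 + a) / (B / (2 * u)) - 1 =
    (dl - M * a - ep + (k - 1) * M + 2 * u * g) / B.
  have -> : ln k^-1 = y + g by rewrite /g; ring.
  have -> : (y + g + a) / (B / (2 * u)) - 1 = (2 * u * y + 2 * u * a + 2 * u * g - B) / B.
    by field; rewrite !gt_eqF.
  by rewrite yE aE /B; congr (_ / _); ring.
rewrite main normrM (@ger0_norm _ B^-1) ?invr_ge0 ?(ltW B0)// ler_pdivrMr//.
have Ma : M <= B by rewrite /B; lra.
have yn : 2 * u * `|y| <= B * (2 + dl + a + ep).
  rewrite -[2 * u]ger0_norm ?(ltW u20)// -normrM yE ler_norml.
  have : 0 <= B * dl by rewrite mulr_ge0// ltW.
  have : 0 <= B * ep by rewrite mulr_ge0// ltW.
  have : M * a <= B * a by rewrite ler_wpM2r.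
  have : 0 <= M * a by rewrite mulr_ge0.
  have : dl <= B * dl by rewrite ler_peMl.
  have : ep <= B * ep by rewrite ler_peMl.
  have : B = L + 3 * M by [].
  by clearbody B => *; apply/andP; split; lra.
have gn : `|2 * u * g| <= k * `|y| * (B * (2 + dl + a + ep)).
  rewrite normrM (@ger0_norm _ (2 * u)) ?(ltW u20)//.
  have : `|g| <= k * y ^+ 2 by rewrite ler_norml; apply/andP; split => //; have := mulr_ge0 (ltW k0) (sqr_ge0 y); lra.
  rewrite -(real_normK (num_real y)) => gy.
  apply: (@le_trans _ _ (2 * u * (k * `|y| ^+ 2))); first by rewrite ler_pM2l.
  rewrite (_ : 2 * u * _ = k * `|y| * (2 * u * `|y|)); last by ring.
  by rewrite ler_wpM2l// mulr_ge0// ltW.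
have kM : `|(k - 1) * M| <= `|k - 1| * B.
  by rewrite normrM (@ger0_norm _ M)// ler_wpM2l.
apply: le_trans (ler_normD _ _) _.
have n1 : `|dl - M * a - ep + (k - 1) * M| <= dl + M * a + ep + `|(k - 1) * M|.
  apply: le_trans (ler_normD _ _) _; rewrite lerD2r ler_norml.
  have : 0 <= M * a by rewrite mulr_ge0.
  by move=> ?; apply/andP; split; lra.
have : dl <= dl * B by rewrite ler_peMr.
have : ep <= ep * B by rewrite ler_peMr.
have : M * a <= a * B by rewrite mulrC ler_wpM2l.
lra.
Qed.

(** * Growth of iterated logarithms *)

Lemma cvg0_le (R : realType) (f g : nat -> R) :
  (\forall n \near \oo, `|g n| <= f n) -> f n @[n --> \oo] --> (0 : R) ->
  g n @[n --> \oo] --> (0 : R).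
Proof.
move=> gf f0; apply: norm_cvg0; apply: (@squeeze_cvgr _ _ _ _ (cst 0) f _ _ 0) => //.
  by apply: filterS gf => n ->; rewrite normr_ge0.
exact: cvg_cst.
Qed.

Lemma cvg_near_eq (R : realType) (f g : nat -> R) (l : R) :
  (\forall n \near \oo, f n = g n) -> f n @[n --> \oo] --> l ->
  g n @[n --> \oo] --> l.
Proof. by move=> fg; apply: cvg_trans; exact: near_eq_cvg. Qed.

Lemma cvg_expR (R : realType) (f : nat -> R) (l : R) :
  f n @[n --> \oo] --> l -> expR (f n) @[n --> \oo] --> expR l.
Proof. by move=> fl; exact: (continuous_cvg _ (@continuous_expR R l) fl). Qed.

Lemma cvgy_ln (R : realType) (f : nat -> R) :
  f n @[n --> \oo] --> +oo -> ln (f n) @[n --> \oo] --> +oo.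
Proof.
move=> /cvgryPge fy; apply/cvgryPge => A.
apply: filterS (fy (expR A)) => n fn; rewrite -[A]expRK.
by rewrite ler_ln// posrE ?expR_gt0// (lt_le_trans (expR_gt0 A)).
Qed.

Lemma cvgy_inv (R : realType) (f : nat -> R) :
  f n @[n --> \oo] --> +oo -> (f n)^-1 @[n --> \oo] --> (0 : R).
Proof.
by move=> fy; apply/gtr0_cvgV0 => //; exact: (cvgry_gt fy 0).
Qed.

(** [f^(k+1) / (k+1)!] is a term of the exponential series of [f]. *)
Lemma cvgy_powM_expRN (R : realType) (f : nat -> R) (k : nat) :
  f n @[n --> \oo] --> +oo -> f n ^+ k * expR (- f n) @[n --> \oo] --> (0 : R).
Proof.
move=> fy; apply: (@cvg0_le _ (fun n => k.+1`!%:R * (f n)^-1)).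
  apply: filterS (cvgry_gt fy 0) => n fn0.
  rewrite ger0_norm; last by rewrite mulr_ge0 ?expR_ge0// exprn_ge0// ltW.
  have F0 : 0 < k.+1`!%:R :> R by rewrite ltr0n fact_gt0.
  rewrite expRN ler_pdivrMr ?expR_gt0// mulrAC ler_pdivlMr// -exprSr.
  rewrite mulrC -ler_pdivrMr//.
  by apply: le_trans (expR_ge1Dxn k (ltW fn0)); rewrite lerDr.
rewrite -[X in _ --> X](mulr0 (k.+1`!%:R)).
by apply: cvgM; [exact: cvg_cst|exact: cvgy_inv].
Qed.

Lemma cvgy_loglog (R : realType) : loglog R n @[n --> \oo] --> +oo.
Proof. by do 2 apply: cvgy_ln; exact: cvgr_idn. Qed.

(** Since [n] exceeds [log n = exp (log log n)]. *)
Lemma loglog_pow_small (R : realType) (k : nat) :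
  loglog R n ^+ k / n%:R @[n --> \oo] --> (0 : R).
Proof.
apply: cvg0_le (cvgy_powM_expRN k (@cvgy_loglog R)).
have [N1 ly uy] : [/\ (n%:R : R) @[n --> \oo] --> +oo,
    (ln n%:R : R) @[n --> \oo] --> +oo & loglog R n @[n --> \oo] --> +oo].
  split; [exact: cvgr_idn|exact/cvgy_ln/cvgr_idn|exact: cvgy_loglog].
near=> n.
have l0 : 0 < ln n%:R :> R by near: n; exact: cvgry_gt.
have u0 : 0 < loglog R n by near: n; exact: cvgry_gt.
have n0 : 0 < n%:R :> R by near: n; exact: cvgry_gt.
rewrite ger0_norm ?divr_ge0 ?exprn_ge0 ?(ltW u0) ?(ltW n0)//.
rewrite ler_wpM2l ?exprn_ge0 ?(ltW u0)// expRN lef_pV2 ?posrE ?expR_gt0//.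
by rewrite /loglog lnK ?posrE// ltW// ln_sublinear.
Unshelve. all: by end_near. Qed.

(** The second-order term of [d^2 = 2 u + L + L^2 / (8 u)]. *)
Definition hc_drift (R : realType) (t : R) (n : nat) : R :=
  ln (loglog R n) + 2 * t - ln pi.

Lemma cvgy_hc_drift (R : realType) (t : R) : hc_drift t n @[n --> \oo] --> +oo.
Proof.
have /cvgryPge vy := cvgy_ln (@cvgy_loglog R).
apply/cvgryPge => A; apply: filterS (vy (A - 2 * t + ln pi)) => n.
by rewrite /hc_drift; lra.
Qed.

Lemma hc_drift_sq_small (R : realType) (t : R) :
  hc_drift t n ^+ 2 / loglog R n @[n --> \oo] --> (0 : R).
Proof.
pose v n := ln (loglog R n); pose c : R := 2 * t - ln pi.
have vy : v n @[n --> \oo] --> +oo by exact: cvgy_ln (@cvgy_loglog R).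
have E : \forall n \near \oo, v n ^+ 2 * expR (- v n)
   + 2 * c * (v n ^+ 1 * expR (- v n)) + c ^+ 2 * (v n ^+ 0 * expR (- v n)) =
   hc_drift t n ^+ 2 / loglog R n.
  near=> n.
  have u0 : 0 < loglog R n by near: n; exact: cvgry_gt (@cvgy_loglog R) 0.
  rewrite expRN /v lnK ?posrE// /hc_drift -/(v n) /c; ring.
apply: (cvg_near_eq E).
rewrite -[X in _ --> X](_ : 0 + 2 * c * 0 + c ^+ 2 * 0 = 0); last by rewrite !mulr0 !addr0.
apply: cvgD; first apply: cvgD; first exact: cvgy_powM_expRN.
- by apply: cvgM; [exact: cvg_cst|exact: cvgy_powM_expRN].
- by apply: cvgM; [exact: cvg_cst|exact: cvgy_powM_expRN].
Unshelve. all: by end_near. Qed.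

Lemma hc_d_sq (R : realType) (t : R) (n : nat) : 0 < loglog R n ->
  hc_d t n ^+ 2 = 2 * loglog R n + hc_drift t n
                    + hc_drift t n ^+ 2 / (8 * loglog R n).
Proof.
move=> u0; rewrite /hc_d exprMn exprVn sqr_sqrtr; last by rewrite mulr_ge0// ltW.
by rewrite /hc_drift; field; rewrite gt_eqF.
Qed.

Lemma expRN_hc_d_sq (R : realType) (t : R) (n : nat) :
  0 < loglog R n -> 0 < ln n%:R :> R ->
  expR (- hc_d t n ^+ 2) = pi * expR (- 2 * t) / (loglog R n * ln n%:R ^+ 2)
    * expR (- (hc_drift t n ^+ 2 / (8 * loglog R n))).
Proof.
move=> u0 l0; rewrite hc_d_sq//.
have P0 := pi_gt0 R.
have -> : pi = expR (ln pi) :> R by rewrite lnK ?posrE.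
have uE : loglog R n = expR (ln (loglog R n)) by rewrite lnK ?posrE.
rewrite [X in _ / (X * ln _ ^+ 2)]uE.
rewrite (_ : ln n%:R = expR (loglog R n)); last by rewrite /loglog lnK ?posrE.
rewrite -expRM_natl -!expRD -expRN -!expRD; congr expR.
by rewrite /hc_drift; ring.
Qed.

(** * Asymptotics of the expected number of exceedances *)

(** Sequences of the order of [log log n] are negligible with respect to [n];
    the next lemma says the same of their products. *)
Lemma cvg_div_n_of_cvg_div_loglog (R : realType) (x : nat -> R) (a : R) :
  x n / loglog R n @[n --> \oo] --> a -> x n / n%:R @[n --> \oo] --> (0 : R).
Proof.
move=> xa; rewrite -(mulr0 a).
apply: cvg_near_eq (cvgM xa (@loglog_pow_small R 1)).
near=> n.
have u0 : 0 < loglog R n by near: n; exact: cvgry_gt (@cvgy_loglog R) 0.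
by rewrite expr1 mulrA divfK// gt_eqF.
Unshelve. all: by end_near. Qed.

Lemma cvg_mul_div_n_of_cvg_div_loglog (R : realType) (x y : nat -> R) (a b : R) :
  x n / loglog R n @[n --> \oo] --> a -> y n / loglog R n @[n --> \oo] --> b ->
  x n * y n / n%:R @[n --> \oo] --> (0 : R).
Proof.
move=> xa yb; rewrite -(mulr0 (a * b)).
apply: cvg_near_eq (cvgM (cvgM xa yb) (@loglog_pow_small R 2)).
near=> n.
have u0 : 0 < loglog R n by near: n; exact: cvgry_gt (@cvgy_loglog R) 0.
have n0 : 0 < n%:R :> R by near: n; exact: nbhs_infty_gtr.
by rewrite /=; field; rewrite !gt_eqF.
Unshelve. all: by end_near. Qed.

Lemma hc_drift_small (R : realType) (t : R) :
  hc_drift t n / loglog R n @[n --> \oo] --> (0 : R).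
Proof.
rewrite -(mulr0 (0 : R)).
apply: cvg_near_eq (cvgM (hc_drift_sq_small t) (cvgy_inv (cvgy_hc_drift t))).
near=> n.
have L0 : 0 < hc_drift t n by near: n; exact: cvgry_gt (cvgy_hc_drift t) 0.
have u0 : 0 < loglog R n by near: n; exact: cvgry_gt (@cvgy_loglog R) 0.
by rewrite /=; field; rewrite !gt_eqF.
Unshelve. all: by end_near. Qed.

Lemma hc_d_sq_equiv (R : realType) (t : R) :
  hc_d t n ^+ 2 / loglog R n @[n --> \oo] --> (2 : R).
Proof.
have L0 := hc_drift_small t.
rewrite -[2](_ : 2 + 0 + 0 * 0 / 8 = 2); last by field.
apply: cvg_near_eq (cvgD (cvgD (cvg_cst (2 : R)) L0) (cvgM (cvgM L0 L0) (cvg_cst (8^-1 : R)))).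
near=> n.
have u0 : 0 < loglog R n by near: n; exact: cvgry_gt (@cvgy_loglog R) 0.
by rewrite hc_d_sq// !fctE /=; field; rewrite gt_eqF.
Unshelve. all: by end_near. Qed.

(** Expected number of variables that are not below the critical value. *)
Definition hc_mean (R : realType) (t : R) (i : nat -> nat) (n : nat) : R :=
  n%:R * (1 - hc_crit (i n) n (hc_d t n)).

Lemma hc_mean_quadratic (R : realType) (t : R) (i : nat -> nat) :
  (forall n, (0 < n)%N -> (1 <= i n <= n)%N) ->
  \forall n \near \oo,
  [/\ 0 <= hc_crit (i n) n (hc_d t n), 0 < hc_d t n ^+ 2,
      hc_d t n ^+ 2 <= hc_mean t i n * (1 + hc_d t n ^+ 2 / n%:R),
      hc_mean t i n <= hc_d t n ^+ 2 + 2 * (n - i n)%N%:R &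
      hc_mean t i n = hc_d t n ^+ 2 + 2 * (n - i n)%N%:R
        - (n - i n)%N%:R ^+ 2 / hc_mean t i n
        - hc_d t n ^+ 2 * hc_mean t i n / n%:R].
Proof.
move=> hi; near=> n.
have u0 : 0 < loglog R n by near: n; exact: cvgry_gt (@cvgy_loglog R) 0.
have L0 : 0 < hc_drift t n by near: n; exact: cvgry_gt (cvgy_hc_drift t) 0.
have n0 : (0 < n)%N by near: n; exact: nbhs_infty_gt.
have /andP[_ i_n] := hi n n0.
have d0 : 0 < hc_d t n.
  rewrite /hc_d divr_gt0// ?sqrtr_gt0 ?mulr_gt0//.
  by move: L0; rewrite /hc_drift; lra.
have [h0 h1 h2 h3] := hc_crit_quadratic n0 i_n d0.
by split => //; rewrite exprn_gt0.
Unshelve. all: by end_near. Qed.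

Lemma hc_mean_gt0 (R : realType) (t : R) (i : nat -> nat) :
  (forall n, (0 < n)%N -> (1 <= i n <= n)%N) ->
  \forall n \near \oo, 0 < hc_mean t i n.
Proof.
move=> hi; apply: filterS (hc_mean_quadratic t hi) => n.
move=> [_ D0 lo _ _].
have E0 : 0 < 1 + hc_d t n ^+ 2 / n%:R by rewrite ltr_pwDl// divr_ge0 ?sqr_ge0.
by rewrite -(pmulr_lgt0 _ E0) (lt_le_trans D0).
Qed.

(** Both bounds on the root are equivalent to [d^2], as [n - i] is negligible
    with respect to [log log n]. *)
Lemma hc_mean_equiv (R : realType) (t : R) (i : nat -> nat) :
  (forall n, (0 < n)%N -> (1 <= i n <= n)%N) ->
  (n - i n)%N%:R / loglog R n @[n --> \oo] --> (0 : R) ->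
  hc_mean t i n / loglog R n @[n --> \oo] --> (2 : R).
Proof.
move=> hi hlim.
have D2 := hc_d_sq_equiv t.
have DN := cvg_div_n_of_cvg_div_loglog D2.
have up : hc_d t n ^+ 2 / loglog R n + 2 * ((n - i n)%N%:R / loglog R n)
    @[n --> \oo] --> (2 : R).
  rewrite -[X in _ --> X](_ : 2 + 2 * 0 = 2); last by rewrite mulr0 addr0.
  by apply: cvgD => //; apply: cvgM => //; exact: cvg_cst.
have lo : hc_d t n ^+ 2 / loglog R n * (1 + hc_d t n ^+ 2 / n%:R)^-1
    @[n --> \oo] --> (2 : R).
  rewrite -[X in _ --> X](_ : 2 * (1 + 0)^-1 = 2); last by rewrite addr0 invr1 mulr1.
  apply: cvgM => //; apply: cvgV; first by rewrite addr0 oner_eq0.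
  by apply: cvgD => //; exact: cvg_cst.
apply: (squeeze_cvgr _ lo up).
apply: filterS2 (cvgry_gt (@cvgy_loglog R) 0) (hc_mean_quadratic t hi) => n u0.
move=> [_ D0 nlo nup _].
have E0 : 0 < 1 + hc_d t n ^+ 2 / n%:R by rewrite ltr_pwDl// divr_ge0 ?sqr_ge0.
apply/andP; split.
  by rewrite mulrAC ler_pM2r ?invr_gt0// ler_pdivrMr.
by rewrite mulrA -mulrDl ler_pM2r ?invr_gt0.
Qed.

(** * Asymptotics of the local levels *)

(** The explicit bounds of [binomial_tail_poisson] involve only [m / nu], [m^2
    / n], [m nu / n] and [nu^2 / n], which all tend to [0]. *)
Lemma local_level_poisson (R : realType) (t : R)
    (disp : nat -> measure_display)
    (T : forall n : nat, measurableType (disp n))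
    (P : forall n : nat, probability (T n) R)
    (U : forall n : nat, 'I_n -> {RV (P n) >-> R})
    (i : nat -> nat) :
  (forall n : nat, iid_uniform (U n)) ->
  (forall n, (0 < n)%N -> (1 <= i n <= n)%N) ->
  (n - i n)%N%:R / loglog R n @[n --> \oo] --> (0 : R) ->
  local_level (U n) (hc_d t n) (i n) /
    poisson_weight (hc_mean t i n) (n - i n) @[n --> \oo] --> (1 : R).
Proof.
move=> hU hi hlim.
pose M n : R := (n - i n)%N%:R; pose nu := hc_mean t i.
have nu2 : nu n / loglog R n @[n --> \oo] --> (2 : R) by exact: hc_mean_equiv.
have nuN : nu n / n%:R @[n --> \oo] --> (0 : R) by exact: cvg_div_n_of_cvg_div_loglog nu2.
have MN : M n / n%:R @[n --> \oo] --> (0 : R) by exact: cvg_div_n_of_cvg_div_loglog hlim.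
have MMN : M n * M n / n%:R @[n --> \oo] --> (0 : R).
  exact: (cvg_mul_div_n_of_cvg_div_loglog hlim hlim).
have MnuN : M n * nu n / n%:R @[n --> \oo] --> (0 : R).
  exact: (cvg_mul_div_n_of_cvg_div_loglog hlim nu2).
have nunuN : nu n * nu n / n%:R @[n --> \oo] --> (0 : R).
  exact: (cvg_mul_div_n_of_cvg_div_loglog nu2 nu2).
have Mnu : M n / nu n @[n --> \oo] --> (0 : R).
  have n2 : (2 : R) != 0 by [].
  rewrite -(mul0r (2^-1 : R)).
  apply: cvg_near_eq (cvgM hlim (cvgV n2 nu2)).
  apply: filterS2 (cvgry_gt (@cvgy_loglog R) 0) (hc_mean_gt0 t hi) => n u0 nu0.
  by rewrite /M /nu /=; field; rewrite !gt_eqF.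
have lo : (1 - M n * M n / n%:R) * expR (- 2 * (nu n * nu n / n%:R))
    @[n --> \oo] --> (1 : R).
  rewrite -[X in _ --> X](_ : (1 - 0) * expR (- 2 * 0) = 1); last first.
    by rewrite mulr0 expR0 subr0 mulr1.
  apply: cvgM; first by apply: cvgB => //; exact: cvg_cst.
  by apply: cvg_expR; apply: cvgM => //; exact: cvg_cst.
have up : expR (M n * nu n / n%:R) * (1 - 2 * (M n / nu n))^-1
    @[n --> \oo] --> (1 : R).
  rewrite -[X in _ --> X](_ : expR 0 * (1 - 2 * 0)^-1 = 1); last first.
    by rewrite mulr0 expR0 subr0 invr1 mulr1.
  apply: cvgM; first exact: cvg_expR.
  apply: cvgV; first by rewrite mulr0 subr0 oner_eq0.
  apply: cvgB; first exact: cvg_cst.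
  by apply: cvgM => //; exact: cvg_cst.
apply: (squeeze_cvgr _ lo up).
near=> n.
have nu0 : 0 < nu n by near: n; exact: hc_mean_gt0.
have n0 : (0 < n)%N by near: n; exact: nbhs_infty_gt.
have h0 : 0 <= hc_crit (i n) n (hc_d t n).
  near: n; apply: filterS (hc_mean_quadratic t hi) => n.
  by move=> [].
have nuh : nu n / n%:R < 1 / 2 by near: n; exact: (cvgr_lt 0 nuN).
have Mh : M n / n%:R < 1 / 2 by near: n; exact: (cvgr_lt 0 MN).
have Mnuh : M n / nu n < 1 / 2 by near: n; exact: (cvgr_lt 0 Mnu).
have N0 : 0 < n%:R :> R by rewrite ltr0n.
set q := nu n / n%:R in nuh.
have q0 : 0 < q by rewrite divr_gt0.
have qE : 1 - hc_crit (i n) n (hc_d t n) = q.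
  by rewrite /q /nu /hc_mean mulrAC divff ?mul1r// gt_eqF.
have nuq : nu n = n%:R * q by rewrite /q mulrCA divff ?mulr1// gt_eqF.
have Mn : (2 * (n - i n) <= n)%N.
  by move: Mh; rewrite ltr_pdivrMr// -(ler_nat R) natrM /M; lra.
have h01 : 0 <= hc_crit (i n) n (hc_d t n) <= 1 by rewrite h0/=; lra.
rewrite (local_level_binomial (hU n) h01 (hi n n0)) qE.
have q2 : 0 < q <= 1 / 2 by rewrite q0 ltW.
have [] := binomial_tail_poisson q2 Mn n0.
rewrite -nuq -/(M n); set p := poisson_weight _ _; set S := \sum_(_ < _) _.
have p0 : 0 < p.
  by rewrite /p mulr_gt0 ?expR_gt0// divr_gt0 ?exprn_gt0 ?nu0// ltr0n fact_gt0.
have -> : n%:R * q ^+ 2 = nu n * nu n / n%:R by rewrite /q; field; rewrite gt_eqF.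
have -> : M n * q = M n * nu n / n%:R by rewrite /q mulrA.
rewrite expr2 -[2 * M n / nu n]mulrA => lS uS.
rewrite ler_pdivlMr// lS/= ler_pdivrMr// mulrAC ler_pdivlMr; last lra.
by rewrite mulrC.
Unshelve. all: by end_near. Qed.

(** The left-hand side is the sequence [w] of the theorem: it collects, for
    each of the [n - i] factors, the correction to the main term of the
    Poisson weight. *)
Lemma hc_mean_exponent (R : realType) (t : R) (i : nat -> nat) :
  (forall n, (0 < n)%N -> (1 <= i n <= n)%N) ->
  (n - i n)%N%:R / loglog R n @[n --> \oo] --> (0 : R) ->
  exists2 eps : nat -> R, eps n @[n --> \oo] --> (0 : R) &
    \forall n \near \oo,
      ln (hc_mean t i n / (2 * loglog R n))
        + (n - i n)%N%:R / hc_mean t i n =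
      (hc_drift t n + 3 * (n - i n)%N%:R) / (2 * loglog R n) * (1 + eps n).
Proof.
move=> hi hlim.
pose M n : R := (n - i n)%N%:R; pose nu := hc_mean t i.
pose base n := (hc_drift t n + 3 * M n) / (2 * loglog R n).
pose s n := ln (nu n / (2 * loglog R n)) + M n / nu n.
exists (fun n => s n / base n - 1); last first.
  apply: filterS2 (cvgry_gt (@cvgy_loglog R) 0) (cvgry_gt (cvgy_hc_drift t) 0) => n u0 L0.
  rewrite -/(s n) -/(base n) addrC subrK mulrCA divff ?mulr1// gt_eqF//.
  by rewrite /base divr_gt0 ?mulr_gt0// ltr_pwDl// mulr_ge0.
have u0near : \forall n \near \oo, 0 < loglog R n by exact: cvgry_gt (@cvgy_loglog R) 0.
have nu2 : nu n / loglog R n @[n --> \oo] --> (2 : R) by exact: hc_mean_equiv.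
have Dnu : hc_d t n ^+ 2 * nu n / n%:R @[n --> \oo] --> (0 : R).
  exact: (cvg_mul_div_n_of_cvg_div_loglog (hc_d_sq_equiv t) nu2).
pose k n := 2 * loglog R n / nu n.
have kV1 : (k n)^-1 @[n --> \oo] --> (1 : R).
  rewrite -[X in _ --> X](_ : 2 * 2^-1 = 1); last by rewrite divff.
  apply: cvg_near_eq (cvgM nu2 (cvg_cst (2^-1 : R))).
  apply: filterS2 u0near (hc_mean_gt0 t hi) => n u0 nu0.
  by rewrite /k /nu /=; field; rewrite !gt_eqF.
have k1 : k n @[n --> \oo] --> (1 : R).
  rewrite -(@invr1 R); apply: cvg_near_eq (cvgV (@oner_neq0 R) kV1).
  by apply: filterE => n; rewrite /= invrK.
have Mnu : M n / nu n @[n --> \oo] --> (0 : R).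
  rewrite -[X in _ --> X](_ : 0 * 1 * 2^-1 = 0); last by rewrite !mul0r.
  apply: cvg_near_eq (cvgM (cvgM hlim k1) (cvg_cst (2^-1 : R))).
  apply: filterS2 u0near (hc_mean_gt0 t hi) => n u0 nu0.
  by rewrite /k /nu /M ?fctE /=; field; rewrite !gt_eqF.
pose dl n := hc_drift t n ^+ 2 / (8 * loglog R n).
have dl0 : dl n @[n --> \oo] --> (0 : R).
  rewrite -[X in _ --> X](_ : 0 * 8^-1 = 0); last by rewrite !mul0r.
  apply: cvg_near_eq (cvgM (hc_drift_sq_small t) (cvg_cst (8^-1 : R))).
  apply: filterS u0near => n u0.
  by rewrite /dl ?fctE /=; field; rewrite gt_eqF.
pose ep n := hc_d t n ^+ 2 * nu n / n%:R.
pose B n := dl n + M n / nu n + ep n + `|k n - 1|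
  + k n * `|(k n)^-1 - 1| * (2 + dl n + M n / nu n + ep n).
have B0 : B n @[n --> \oo] --> (0 : R).
  rewrite -[X in _ --> X](_ : 0 + 0 + 0 + `|1 - 1| + 1 * `|1 - 1| * (2 + 0 + 0 + 0) = 0); last first.
    by rewrite subrr normr0; ring.
  have c1 : (1 : R) @[n --> \oo] --> (1 : R) by exact: cvg_cst.
  apply: cvgD; [apply: cvgD|apply: cvgM].
  - by apply: cvgD => //; exact: cvgD.
  - by apply: cvg_norm; exact: cvgB.
  - by apply: cvgM => //; apply: cvg_norm; exact: cvgB.
  - by apply: cvgD => //; apply: cvgD => //; apply: cvgD => //; exact: cvg_cst.
apply: cvg0_le B0.
near=> n.
have u0 : 0 < loglog R n by near: n.
have nu0 : 0 < nu n by near: n; exact: hc_mean_gt0.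
have L1 : 1 <= hc_drift t n by near: n; exact: cvgry_ge (cvgy_hc_drift t) 1.
apply: exponent_asymptotics => //.
- by rewrite /dl divr_ge0 ?sqr_ge0// mulr_ge0// ltW.
- by rewrite /ep divr_ge0// mulr_ge0 ?sqr_ge0// ltW.
- rewrite /dl -hc_d_sq//.
  near: n; apply: filterS (hc_mean_quadratic t hi) => n.
  by move=> [].
Unshelve. all: by end_near. Qed.

(** The common source of both claims. Replacing [nu] in [nu^m exp (- nu)] by
    its fixed-point relation produces the main term and the correction [exp (m
    w)]; the terms [D nu / n] and [L^2 / (8 u)] left in the exponent tend to
    [0]. *)
Lemma local_level_expansion (R : realType) (t : R)
    (disp : nat -> measure_display)
    (T : forall n : nat, measurableType (disp n))
    (P : forall n : nat, probability (T n) R)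
    (U : forall n : nat, 'I_n -> {RV (P n) >-> R})
    (i : nat -> nat) :
  (forall n : nat, iid_uniform (U n)) ->
  (forall n, (0 < n)%N -> (1 <= i n <= n)%N) ->
  (n - i n)%N%:R / loglog R n @[n --> \oo] --> (0 : R) ->
  exists eps b : nat -> R,
  [/\ eps n @[n --> \oo] --> (0 : R), b n @[n --> \oo] --> (0 : R) &
    \forall n \near \oo,
      local_level (U n) (hc_d t n) (i n) =
        pi * expR (- 2 * t) / (loglog R n * ln n%:R ^+ 2)
        * (2 * loglog R n / expR 2) ^+ (n - i n) * (1 / (n - i n)`!%:R)
        * expR ((n - i n)%N%:R *
            ((hc_drift t n + 3 * (n - i n)%N%:R) / (2 * loglog R n) * (1 + eps n)))
        * (1 + b n)].
Proof.
move=> hU hi hlim.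
have [eps eps0 epsE] := hc_mean_exponent t hi hlim.
pose nu := hc_mean t i.
pose p n := poisson_weight (nu n) (n - i n).
pose ratio n := local_level (U n) (hc_d t n) (i n) / p n.
pose ep n := hc_d t n ^+ 2 * nu n / n%:R.
pose dl n := hc_drift t n ^+ 2 / (8 * loglog R n).
have u0near : \forall n \near \oo, 0 < loglog R n by exact: cvgry_gt (@cvgy_loglog R) 0.
have nu2 : nu n / loglog R n @[n --> \oo] --> (2 : R) by exact: hc_mean_equiv.
have ep0 : ep n @[n --> \oo] --> (0 : R).
  exact: (cvg_mul_div_n_of_cvg_div_loglog (hc_d_sq_equiv t) nu2).
have dl0 : dl n @[n --> \oo] --> (0 : R).
  rewrite -[X in _ --> X](_ : 0 * 8^-1 = 0); last by rewrite !mul0r.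
  apply: cvg_near_eq (cvgM (hc_drift_sq_small t) (cvg_cst (8^-1 : R))).
  apply: filterS u0near => n u0.
  by rewrite /dl ?fctE /=; field; rewrite gt_eqF.
have ratio1 : ratio n @[n --> \oo] --> (1 : R) by exact: local_level_poisson.
exists eps, (fun n => ratio n * expR (ep n - dl n) - 1); split => //.
  rewrite -[X in _ --> X](_ : 1 * expR (0 - 0) - 1 = 0); last first.
    by rewrite subrr expR0 mulr1 subrr.
  apply: cvgB; last exact: cvg_cst.
  by apply: cvgM => //; apply: cvg_expR; exact: cvgB.
near=> n.
have u0 : 0 < loglog R n by near: n.
have l0 : 0 < ln n%:R :> R by near: n; exact: cvgry_gt (cvgy_ln cvgr_idn) 0.
have nu0 : 0 < nu n by near: n; exact: hc_mean_gt0.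
have sE : ln (nu n / (2 * loglog R n)) + (n - i n)%N%:R / nu n =
    (hc_drift t n + 3 * (n - i n)%N%:R) / (2 * loglog R n) * (1 + eps n).
  by near: n; exact: epsE.
have quad : nu n = hc_d t n ^+ 2 + 2 * (n - i n)%N%:R
    - (n - i n)%N%:R ^+ 2 / nu n - ep n.
  near: n; apply: filterS (hc_mean_quadratic t hi) => n.
  by move=> [].
rewrite -sE (addrC 1) subrK.
set m := (n - i n)%N in quad sE *; set M : R := m%:R in quad sE *.
have F0 : 0 < m`!%:R :> R by rewrite ltr0n fact_gt0.
have p0 : 0 < p n by rewrite /p mulr_gt0 ?expR_gt0// divr_gt0 ?exprn_gt0.
have -> : local_level (U n) (hc_d t n) (i n) = p n * ratio n.
  by rewrite /ratio mulrCA divff ?mulr1// gt_eqF.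
set u := loglog R n in u0 sE *.
have powE (x : R) : 0 < x -> x ^+ m = expR (M * ln x).
  by move=> x0; rewrite expRM_natl lnK.
have e20 : 0 < expR 2 :> R by exact: expR_gt0.
have u20 : 0 < 2 * u by rewrite mulr_gt0.
have key : nu n ^+ m * expR (- nu n) = expR (- hc_d t n ^+ 2) * (2 * u / expR 2) ^+ m
    * expR (M * (ln (nu n / (2 * u)) + M / nu n)) * expR (ep n).
  rewrite !powE ?divr_gt0// !ln_div ?posrE// expRK -!expRD; congr expR.
  by move: quad; set x := ln (nu n); set y := ln (2 * u); lra.
rewrite /p /poisson_weight (_ : _ / _ * _ = (nu n ^+ m * expR (- nu n)) / m`!%:R); last by ring.
have dlE : dl n = hc_drift t n ^+ 2 / (8 * u) by [].
rewrite key expRN_hc_d_sq// -/u -dlE (expRD (ep n)).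
ring.
Unshelve. all: by end_near. Qed.

(** * The two expansions *)

Theorem lemma4p2 (R : realType) (t : R)
    (disp : nat -> measure_display)
    (T : forall n : nat, measurableType (disp n))
    (P : forall n : nat, probability (T n) R)
    (U : forall n : nat, 'I_n -> {RV (P n) >-> R})
    (hU : forall n : nat, iid_uniform (U n))
    (i : nat -> nat)
    (hi : forall n : nat, (0 < n)%N -> (1 <= i n <= n)%N)
    (hlim : (n - i n)%N%:R / loglog R n @[n --> \oo] --> (0 : R)) :
  let u : nat -> R := loglog R in
  let alpha : nat -> R := fun n => local_level (U n) (hc_d t n) (i n) in
  let gamma : R := expR 1 / 2 in
  (exists w eps A B : nat -> R,
     [/\ eps =o_\oo (fun=> 1 : R),
         \forall n \near \oo,
           w n = (ln (u n) + 2 * t - ln pi + 3 * (n - i n)%N%:R) / (2 * u n)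
                   * (1 + eps n),
         exists C : R, \forall n \near \oo,
           (i n <= n.-1)%N -> `|A n| <= C / (n - i n)%N%:R,
         B =o_\oo (fun=> 1 : R)
       & \forall n \near \oo, (i n <= n.-1)%N ->
           alpha n = Num.sqrt pi * expR (- 2 * t)
                       / Num.sqrt (2 * (n - i n)%N%:R)
                     * (1 / (u n * ln n%:R ^+ 2))
                     * (u n / (gamma * (n - i n)%N%:R)) ^+ (n - i n)
                     * expR ((n - i n)%N%:R * w n)
                     * (1 + A n + B n)])
  /\
  ((fun n => (n - i n)%N%:R : R) =o_\oo (fun n => Num.sqrt (u n)) ->
   exists2 eps : nat -> R, eps =o_\oo (fun=> 1 : R) &
     \forall n \near \oo,
       alpha n = pi * expR (- 2 * t) / (u n * ln n%:R ^+ 2)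
                 * (2 * u n / expR 2) ^+ (n - i n)
                 * (1 / (n - i n)`!%:R)
                 * (1 + eps n)).
Proof.
move=> u alpha gamma.
have [eps [b [eps0 b0 alphaE]]] := local_level_expansion t hU hi hlim.
have [A0 [A0le A0E]] := stirling R.
pose m n := (n - i n)%N; pose M n : R := (m n)%:R.
pose base n := (hc_drift t n + 3 * M n) / (2 * u n).
have unear : \forall n \near \oo, 0 < u n by exact: cvgry_gt (@cvgy_loglog R) 0.
have o1 (f : nat -> R) : f n @[n --> \oo] --> (0 : R) -> f =o_\oo (fun=> 1 : R).
  by move=> f0; apply/eqolim0P.
split.
  (* The error term in Stirling's formula is only controlled at positive
     arguments; the value 0 elsewhere keeps the sequence bounded. *)
  pose A n := if m n == 0%N then 0 else A0 (m n).
  exists (fun n => base n * (1 + eps n)), eps, A, (fun n => (1 + A n) * b n); split.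
  - exact: o1.
  - by apply: filterE => n; rewrite /base /hc_drift -/(u n) -/(M n).
  - exists (expR 1); near=> n => i_n.
    have n0 : (0 < n)%N by near: n; exact: nbhs_infty_gt.
    have m0 : (0 < m n)%N by rewrite /m; lia.
    by rewrite /A gtn_eqF// A0le.
  - apply: o1; apply: (@cvg0_le _ (fun n => (1 + expR 1) * `|b n|)).
      apply: filterE => n; rewrite normrM ler_wpM2r//.
      apply: le_trans (ler_normD _ _) _; rewrite normr1 lerD2l /A.
      case: eqP => [_|/eqP mn0]; first by rewrite normr0 expR_ge0.
      have m0 : (0 < m n)%N by rewrite lt0n.
      apply: le_trans (A0le _ m0) _; rewrite ler_pdivrMr ?ltr0n//.
      by rewrite ler_peMr ?expR_ge0// ler1n.
    rewrite -[X in _ --> X](_ : (1 + expR 1) * `|0 : R| = 0); last by rewrite normr0 mulr0.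
    apply: cvgM; [exact: cvg_cst|exact: (cvg_norm b0)].
  - near=> n => i_n.
    have n0 : (0 < n)%N by near: n; exact: nbhs_infty_gt.
    have u0 : 0 < u n by near: n.
    have l0 : 0 < ln n%:R :> R by near: n; exact: cvgry_gt (cvgy_ln cvgr_idn) 0.
    have m0 : (0 < m n)%N by rewrite /m; lia.
    have M0 : 0 < M n by rewrite ltr0n.
    have -> : alpha n = pi * expR (- 2 * t) / (u n * ln n%:R ^+ 2)
        * (2 * u n / expR 2) ^+ m n * (1 / (m n)`!%:R)
        * expR (M n * (base n * (1 + eps n))) * (1 + b n).
      by near: n; exact: alphaE.
    rewrite A0E// -/(M n) /A gtn_eqF//.
    have P0 := pi_gt0 R.
    have sP0 : 0 < Num.sqrt pi :> R by rewrite sqrtr_gt0.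
    have sM0 : 0 < Num.sqrt (2 * M n) by rewrite sqrtr_gt0 mulr_gt0.
    have -> : Num.sqrt (2 * pi * M n) = Num.sqrt pi * Num.sqrt (2 * M n).
      by rewrite -sqrtrM ?(ltW P0)//; congr Num.sqrt; ring.
    have -> : (u n / (gamma * M n)) ^+ m n =
        (2 * u n / expR 2) ^+ m n * (expR 1 / M n) ^+ m n.
      rewrite -exprMn; congr (_ ^+ _).
      have -> : expR 2 = expR 1 ^+ 2 :> R by rewrite -expRM_natl mulr1.
      by rewrite /gamma; field; rewrite !gt_eqF ?expR_gt0.
    have {1}-> : pi = Num.sqrt pi ^+ 2 :> R by rewrite sqr_sqrtr// ltW.
    by field; rewrite !gt_eqF.
move=> oM.
have Mu : M n / Num.sqrt (u n) @[n --> \oo] --> (0 : R).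
  apply/cvgr0Pnorm_le => e e0.
  have /eqoP/(_ e e0) := oM.
  apply: filterS2 unear => n u0 Mle.
  have su0 : 0 < Num.sqrt (u n) by rewrite sqrtr_gt0.
  rewrite normrM (@gtr0_norm _ (_^-1)) ?invr_gt0// ler_pdivrMr//.
  by move: Mle; rewrite (gtr0_norm su0).
have MMu : M n ^+ 2 / u n @[n --> \oo] --> (0 : R).
  rewrite -(mulr0 (0 : R)); apply: cvg_near_eq (cvgM Mu Mu).
  apply: filterS unear => n u0 /=.
  by rewrite mulrACA -expr2 -invfM -expr2 sqr_sqrtr// ltW.
have Mb : M n * base n @[n --> \oo] --> (0 : R).
  (* From 2 L M <= L^2 + M^2, applied to M (L + 3 M) / (2 u). *)
  apply: (@cvg0_le _ (fun n => 4^-1 * (hc_drift t n ^+ 2 / u n) + 7 / 4 * (M n ^+ 2 / u n))).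
    have Lnear : \forall n \near \oo, 0 < hc_drift t n.
      exact: cvgry_gt (cvgy_hc_drift t) 0.
    apply: filterS2 unear Lnear => n u0 L0.
    have M0 : 0 <= M n by [].
    rewrite ger0_norm; last first.
      by apply: mulr_ge0 => //; apply: divr_ge0; lra.
    rewrite -subr_ge0 (_ : _ - _ = (hc_drift t n - M n) ^+ 2 / (4 * u n)); last first.
      by rewrite /base; field; rewrite gt_eqF.
    by rewrite divr_ge0 ?sqr_ge0// mulr_ge0// ltW.
  rewrite -[X in _ --> X](_ : 4^-1 * 0 + 7 / 4 * 0 = 0); last by rewrite !mulr0 addr0.
  apply: cvgD; apply: cvgM => //; try exact: cvg_cst.
  exact: hc_drift_sq_small.
exists (fun n => expR (M n * (base n * (1 + eps n))) * (1 + b n) - 1).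
  apply: o1.
  rewrite -[X in _ --> X](_ : expR (0 * (1 + 0)) * (1 + 0) - 1 = 0); last first.
    by rewrite mul0r expR0 addr0 mulr1 subrr.
  apply: cvgB; last exact: cvg_cst.
  apply: cvgM; last by apply: cvgD => //; exact: cvg_cst.
  apply: cvg_expR; under eq_fun do rewrite mulrA.
  by apply: cvgM => //; apply: cvgD => //; exact: cvg_cst.
apply: filterS alphaE => n; rewrite /alpha => ->.
by rewrite subrKC -!mulrA.
Unshelve. all: by end_near. Qed.
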